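(* Let $H$ be a separable complex Hilbert space, $J$ a conjugation in $H$, and let $A$ be a unitary operator in $H$. Then $A$ admits a representation $$A=R\,e^{iS},$$ where $R$ is a J-real unitary operator in $H$ and $S$ is a bounded J-real self-adjoint operator in $H$.
   Context: A conjugation in a Hilbert space $H$ is a map $J:H\to H$ with $J^2=E$ (the identity) and $(Jx,Jy)=\overline{(x,y)}$ for all $x,y\in H$ (hence $J$ is antilinear). A bounded operator $B$ on $H$ is J-real if it commutes with $J$, i.e. $JBJ=B$. *)

(* Defs.v *)
From HB Require Import structures.
From mathcomp Require Import all_boot all_order all_algebra.
From mathcomp Require Import sesquilinear complex.
From mathcomp Require Import all_classical all_reals all_analysis.

Set Implicit Arguments.
Unset Strict Implicit.
Unset Printing Implicit Defensive.

Import Order.TTheory GRing.Theory Num.Theory.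
Import numFieldNormedType.Exports.
Local Open Scope classical_set_scope.
Local Open Scope ring_scope.

Definition separable_space (X : topologicalType) :=
  exists2 D : set X, countable D & dense D.

Section operators.
Context {R : realType} {H : completeNormedModType R[i]}.
Implicit Types (dot : {dot H for Num.conj}) (T : H -> H).

(* A [dot] form is positive definite and linear in its first argument; under
   this condition the complete space [H] is a Hilbert space. *)
Definition induces_norm dot := forall x : H, `|x| ^+ 2 = dot x x.

Definition conjugation dot (J : H -> H) :=
  involutive J /\ forall x y, dot (J x) (J y) = (dot x y)^*.

Definition J_real (J T : H -> H) := forall x, J (T (J x)) = T x.

(* [M] lives in [R[i]] because norms do; it is necessarily real and
   nonnegative unless [H] is trivial. *)
Definition bounded_op T := exists M : R[i], forall x, `|T x| <= M * `|x|.

Definition unitary_op dot (U : {linear H -> H}) :=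
  (forall x y, dot (U x) (U y) = dot x y) /\ (forall y, exists x, U x = y).

Definition selfadjoint_op dot (S : {linear H -> H}) :=
  forall x y, dot (S x) y = dot x (S y).

Definition op_exp_coeff T (x : H) : H ^nat :=
  fun k => (k`!%:R)^-1 *: iter k T x.

(* The sum of the exponential series of [T], evaluated at [x]. For bounded
   linear [T] it is the sum in the operator norm, by [op_exp_norm_cvg]. *)
Definition op_exp T (x : H) : H := limn (series (op_exp_coeff T x)).

End operators.

Section op_exp_norm_cvg.
Context {R : realType} {H : completeNormedModType R[i]}.
Implicit Types (T : {linear H -> H}) (x : H).

Let iter_bound T (c : R[i]) k x : 0 <= c ->
  (forall x, `|T x| <= c * `|x|) -> `|iter k T x| <= c ^+ k * `|x|.
Proof.
move=> c0 Tc; elim: k => [|k IH]; first by rewrite mul1r.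
by rewrite iterS (le_trans (Tc _))// exprS -mulrA ler_wpM2l.
Qed.

Let series_bound T (c : R) x m n : 0 <= c -> (m <= n)%N ->
  (forall x, `|T x| <= c%:C%C * `|x|) ->
  `|series (op_exp_coeff T x) n - series (op_exp_coeff T x) m| <=
  (series (exp_coeff c) n - series (exp_coeff c) m)%:C%C * `|x|.
Proof.
move=> c0 mn Tc; rewrite !sub_series_geq// (le_trans (ler_norm_sum _ _ _))//.
rewrite rmorph_sum/= mulr_suml ler_sum// => k _.
rewrite normrZ normfV normr_nat /exp_coeff/= rmorphM rmorphXn/= fmorphV rmorph_nat.
rewrite mulrAC mulrC ler_wpM2r ?invr_ge0 ?ler0n//.
by apply: iter_bound => //; rewrite lecR.
Qed.

Let series_cauchy T (e : R[i]) : bounded_op T -> 0 < e ->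
  exists N : nat, forall m n x, (N <= m)%N -> (N <= n)%N ->
  `|series (op_exp_coeff T x) n - series (op_exp_coeff T x) m| <= e * `|x|.
Proof.
move=> [M TM] e0.
have [c c0 Tc] : exists2 c : R, 0 <= c & forall x, `|T x| <= c%:C%C * `|x|.
  have /complex_realP[c cE] : `|M| \is Num.real by rewrite normr_real.
  exists c => [|x]; first by rewrite -lecR -cE; exact: normr_ge0.
  rewrite -cE -[`|x| in leRHS]normr_id -normrM ger0_norm//.
  by rewrite (le_trans _ (TM x)).
have /complex_realP[d dE] : e \is Num.real by rewrite gtr0_real.
have d0 : 0 < d by rewrite -ltcR -dE.
have /cauchy_cvgP/cauchy_seriesP/(_ d d0) := is_cvg_series_exp_coeff c.
move=> [[A B] [[N1 _ HA] [N2 _ HB]] AB].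
pose N := maxn N1 N2; exists N.
have key m n x : (N <= m)%N -> (m <= n)%N ->
    `|series (op_exp_coeff T x) n - series (op_exp_coeff T x) m| <= e * `|x|.
  move=> Nm mn; apply: (le_trans (series_bound _ c0 mn Tc)).
  rewrite ler_wpM2r// dE lecR sub_series_geq//.
  have /= := AB (m, n) _; move=> h; apply: (le_trans (ler_norm _)); apply/ltW/h.
  split; [apply: HA|apply: HB] => /=.
    by rewrite (leq_trans _ Nm)// leq_maxl.
  by rewrite (leq_trans _ (leq_trans Nm mn))// leq_maxr.
move=> m n x Nm Nn; have [mn|/ltnW nm] := leqP m n; first exact: key.
by rewrite distrC key.
Qed.

Lemma is_cvg_op_exp T x : bounded_op T -> cvgn (series (op_exp_coeff T x)).
Proof.
move=> bT; apply/cauchy_cvgP/cauchy_ballP => e e0; rewrite near_simpl.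
have e'0 : 0 < e / (1 + `|x|) by rewrite divr_gt0// ltr_pwDl.
have [N HN] := series_cauchy bT e'0.
exists ([set n | (N <= n)%N], [set n | (N <= n)%N]); first by split; exists N.
move=> [m n] [/= Nm Nn]; rewrite -ball_normE/= distrC.
rewrite (le_lt_trans (HN _ _ _ Nm Nn))// mulrAC ltr_pdivrMr ?ltr_pwDl//.
by rewrite ltr_pM2l// ltrDr.
Qed.

Lemma op_exp_norm_cvg T (e : R[i]) : bounded_op T -> 0 < e ->
  \forall n \near \oo, forall x,
    `|op_exp T x - series (op_exp_coeff T x) n| <= e * `|x|.
Proof.
move=> bT e0; have [N HN] := series_cauchy bT e0; exists N => // n /= Nn x.
have cT : cvgn (series (op_exp_coeff T x)) by exact: is_cvg_op_exp.
apply/ler_addgt0Pr => d d0; near \oo => m.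
rewrite (le_trans (ler_distD (series (op_exp_coeff T x) m) _ _))// addrC lerD//.
  by apply: HN => //; near: m; exists N.
by near: m; exact: cvgr_dist_le cT d d0.
Unshelve. all: by end_near. Qed.

End op_exp_norm_cvg.

(* Main.v *)
Require Import Defs.
From HB Require Import structures.
From mathcomp Require Import all_boot all_order all_algebra.
From mathcomp Require Import sesquilinear complex ring lra.
From mathcomp Require Import all_classical all_reals all_analysis.

Set Implicit Arguments.
Unset Strict Implicit.
Unset Printing Implicit Defensive.

Import Order.TTheory GRing.Theory Num.Theory.
Import numFieldNormedType.Exports.
Local Open Scope classical_set_scope.
Local Open Scope ring_scope.

(** The operator [U = J A^-1 J A] is unitary and [J U J] is its inverse. Suppose
    that [U = W ^ 2] where [W = e ^ (i S)] with [S] bounded, selfadjoint and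
    J-real. Then [J W J = W^-1], and [V = A W^-1] is J-real:
    [J V J = J A J W = A (A^-1 J A J) W = A U^-1 W = A W^-1]. So one has to take
    a square root of [U] and a logarithm of that root, both real with respect to
    [J].

    Write [U = C + i D] with commuting selfadjoint [C] and [D]; both are J-real
    and [C ^ 2 + D ^ 2 = 1]. All further constructions take place in a
    commutative real algebra of symmetric operators which commute with
    everything that commutes with [C] and [D], in particular with [J]; see
    [csa_spec]. That algebra is closed under strong limits
    ([csa_strong_limit]), and it contains the required functions of [C] and [D]:

    - square roots of [1 - X] for a contraction [X] are limits in norm of an
      explicit iteration ([csa_sqrt]);
    - if [M ^ 2 = D ^ 2], a symmetry [G] with [G D = M] is obtained from the
      projection onto the kernel of [M - D], a strong limit of powers of a
      contraction ([csa_sign]); this is the only discontinuous step, and it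
      handles the spectrum of [U] near [-1];
    - the half-angle formulas then give a square root [C' + i D'] of [C + i D]
      with nonnegative real part ([circle_sqrt]);
    - iterating square roots gives unitary operators [W_n] with
      [W_n ^ (2 ^ n) = W] that approach the identity, and
      [S = lim 2 ^ n Im W_n] satisfies [e ^ (i S) = W] ([csa_log]). *)

(** * Real-valued norm and inner product *)

Section RealGeometry.
Context {R : realType} {H : completeNormedModType R[i]}.
Implicit Types (x y z l : H) (u v : nat -> H) (F T : H -> H) (c e : R).

(** Norms of [H] live in [R[i]], which is only partially ordered; their real
    values make linear arithmetic over [R] available. *)
Definition nrm x : R := complex.Re `|x|.

Lemma nrmE x : `|x| = (nrm x)%:C%C.
Proof. by rewrite /nrm RRe_real// normr_real. Qed.

Lemma nrm_ge0 x : 0 <= nrm x.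
Proof. by rewrite -lecR -nrmE normr_ge0. Qed.

Lemma nrm_eq0 x : nrm x = 0 -> x = 0.
Proof. by move=> x0; apply/eqP; rewrite -normr_eq0 nrmE x0. Qed.

Lemma nrm0 : nrm 0 = 0.
Proof. by rewrite /nrm normr0. Qed.

Lemma nrmN x : nrm (- x) = nrm x.
Proof. by rewrite /nrm normrN. Qed.

Lemma nrmB x y : nrm (x - y) = nrm (y - x).
Proof. by rewrite -nrmN opprB. Qed.

Lemma nrmD x y : nrm (x + y) <= nrm x + nrm y.
Proof. by rewrite -lecR rmorphD/= -!nrmE ler_normD. Qed.

Lemma nrm_triangle y x z : nrm (x - z) <= nrm (x - y) + nrm (y - z).
Proof. by rewrite (le_trans _ (nrmD _ _))// addrA subrK. Qed.

Lemma nrmZ (a : R[i]) x : nrm (a *: x) = complex.Re `|a| * nrm x.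
Proof.
apply/complexI; rewrite rmorphM -!nrmE normrZ; congr (_ * _).
by apply/esym/RRe_real; rewrite normr_real.
Qed.

Lemma nrmZr c x : nrm (c%:C%C *: x) = `|c| * nrm x.
Proof. by rewrite nrmZ normc_def/= expr0n addr0 sqrtr_sqr. Qed.

Definition tends u l :=
  forall e, 0 < e -> exists N : nat, forall n, (N <= n)%N -> nrm (u n - l) <= e.

Lemma cauchy_tends u :
  (forall e, 0 < e -> exists N : nat, forall m n,
    (N <= m <= n)%N -> nrm (u n - u m) <= e) -> exists l, tends u l.
Proof.
move=> uC; suff uc : cvgn u.
  exists (limn u) => e e0.
  have e0' : (0 : R[i]) < e%:C%C by rewrite ltcR.
  have [N _ HN] : \forall n \near \oo, `|limn u - u n| <= e%:C%C.
    exact: cvgr_dist_le uc _ e0'.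
  by exists N => n Nn; rewrite nrmB -lecR -nrmE; exact: HN.
apply/cauchy_cvgP/cauchy_ballP => e e0; rewrite near_simpl.
have /complex_realP[d dE] : e \is Num.real by rewrite gtr0_real.
have d0 : 0 < d / 2 by rewrite divr_gt0// -ltcR -dE.
have [N HN] := uC _ d0.
exists ([set n | (N <= n)%N], [set n | (N <= n)%N]); first by split; exists N.
move=> [m n] [/= Nm Nn]; rewrite -ball_normE/= nrmE dE ltcR.
apply: (@le_lt_trans _ _ (d / 2)); last by move: d0; lra.
have [mn|/ltnW nm] := leqP m n; first by rewrite nrmB; apply: HN; rewrite Nm.
by apply: HN; rewrite Nn.
Qed.

Lemma le_eps c d : (forall e, 0 < e -> c <= d + e) -> c <= d.
Proof. by move=> h; apply/ler_addgt0Pr. Qed.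

Lemma tends_nrm_le u l x c N :
  tends u l -> (forall n, (N <= n)%N -> nrm (u n - x) <= c) -> nrm (l - x) <= c.
Proof.
move=> ul ux; apply: le_eps => e /ul[M HM].
have := nrm_triangle (u (maxn M N)) l x.
rewrite (nrmB l (u _)).
have := HM (maxn M N) (leq_maxl _ _).
have := ux (maxn M N) (leq_maxr _ _).
lra.
Qed.

Lemma tends_unique u l l' : tends u l -> tends u l' -> l = l'.
Proof.
move=> ul ul'; apply/eqP; rewrite -subr_eq0; apply/eqP/nrm_eq0.
apply/eqP; rewrite eq_le nrm_ge0 andbT; apply: le_eps => e e0.
rewrite add0r; have [N HN] := ul' e e0.
exact: (tends_nrm_le ul HN).
Qed.

Lemma eq_tends u v l : u =1 v -> tends u l -> tends v l.
Proof. by move=> /funext ->. Qed.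

Lemma tendsD u v l l' : tends u l -> tends v l' ->
  tends (fun n => u n + v n) (l + l').
Proof.
move=> ul vl e e0; have e20 : 0 < e / 2 by rewrite divr_gt0.
have [M HM] := ul _ e20; have [N HN] := vl _ e20.
exists (maxn M N) => n; rewrite geq_max => /andP[/HM h1 /HN h2].
by rewrite opprD addrACA (le_trans (nrmD _ _))//; lra.
Qed.

Definition opnorm_le c T := forall x, nrm (T x) <= c * nrm x.

(** Additivity rather than linearity, so that conjugations are included. *)
Definition bounded_additive F :=
  (forall x y, F (x + y) = F x + F y) /\ exists c, opnorm_le c F.

Lemma bounded_additiveB F x y : bounded_additive F -> F (x - y) = F x - F y.
Proof. by move=> [FD _]; apply/eqP; rewrite eq_sym subr_eq -FD subrK. Qed.

Lemma opnorm_leW c d T : c <= d -> opnorm_le c T -> opnorm_le d T.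
Proof. by move=> cd Tc x; rewrite (le_trans (Tc x))// ler_wpM2r// nrm_ge0. Qed.

Lemma opnorm_leD c d (f g : H -> H) :
  opnorm_le c f -> opnorm_le d g -> opnorm_le (c + d) (fun x => f x + g x).
Proof. by move=> fc gd x; rewrite mulrDl (le_trans (nrmD _ _)) ?lerD. Qed.

Lemma opnorm_leN c (f : H -> H) : opnorm_le c f -> opnorm_le c (fun x => - f x).
Proof. by move=> fc x; rewrite nrmN. Qed.

Lemma opnorm_leM c d (f g : H -> H) : 0 <= c ->
  opnorm_le c f -> opnorm_le d g -> opnorm_le (c * d) (f \o g).
Proof. by move=> c0 fc gd x; rewrite (le_trans (fc _))// -mulrA ler_wpM2l. Qed.

Lemma opnorm_le_half : opnorm_le 2^-1 (fun x : H => (2^-1)%:C%C *: x).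
Proof. by move=> x; rewrite nrmZr ger0_norm. Qed.

Lemma opnorm_le1 : opnorm_le 1 (fun x : H => x).
Proof. by move=> x; rewrite mul1r. Qed.

Lemma bounded_additive0 F : bounded_additive F -> F 0 = 0.
Proof.
by move=> Fb; rewrite -[X in F X](subrr 0) bounded_additiveB// subrr.
Qed.

Lemma bounded_additiveN F x : bounded_additive F -> F (- x) = - F x.
Proof.
by move=> Fb; rewrite -sub0r bounded_additiveB// bounded_additive0// sub0r.
Qed.

Lemma tends_bounded_additive F u l :
  bounded_additive F -> tends u l -> tends (F \o u) (F l).
Proof.
move=> Fb ul e e0; have [_ [c /opnorm_leW Fc]] := Fb.
have d0 : 0 < `|c| + 1 by rewrite ltr_wpDl.
have [N HN] := ul (e / (`|c| + 1)) (divr_gt0 e0 d0).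
exists N => n /HN h; rewrite /= -bounded_additiveB//.
rewrite (le_trans (Fc (`|c| + 1) _ _))//.
  by rewrite (le_trans (ler_norm _))// lerDl.
by rewrite mulrC -ler_pdivlMr.
Qed.

Lemma scaler_bounded_additive (a : R[i]) : bounded_additive (fun x => a *: x).
Proof.
split=> [x y|]; first by rewrite scalerDr.
by exists (complex.Re `|a|) => x; rewrite nrmZ.
Qed.

Section InnerProduct.
Variable dot : {dot H for Num.conj}.

(** The real part of the inner product makes [H] a real Hilbert space, in which
    a conjugation is just a symmetric involution. *)
Definition rdot x y : R := complex.Re (dot x y).

Lemma rdotC x y : rdot x y = rdot y x.
Proof.
apply/complexI; rewrite /rdot (hermC dot) expr0 mul1r.
by rewrite !complexRe; exact: Re_conj.
Qed.

Lemma rdotDl x y z : rdot (x + y) z = rdot x z + rdot y z.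
Proof. by rewrite /rdot linearDl raddfD. Qed.

Lemma rdotDr x y z : rdot z (x + y) = rdot z x + rdot z y.
Proof. by rewrite rdotC rdotDl !(rdotC z). Qed.

Lemma rdotNl x y : rdot (- x) y = - rdot x y.
Proof. by rewrite /rdot linearNl raddfN. Qed.

Lemma rdotNr x y : rdot x (- y) = - rdot x y.
Proof. by rewrite rdotC rdotNl rdotC. Qed.

Hypothesis Hdot : induces_norm dot.

Lemma rdotE x : rdot x x = nrm x ^+ 2.
Proof. by rewrite /rdot -Hdot nrmE -rmorphXn. Qed.

(** Cauchy-Schwarz, from the triangle inequality squared. *)
Lemma rdot_le x y : rdot x y <= nrm x * nrm y.
Proof.
have h : rdot (x + y) (x + y) <= (nrm x + nrm y) ^+ 2.
  by rewrite rdotE ler_sqr ?nnegrE ?addr_ge0 ?nrm_ge0// nrmD.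
move: h; rewrite rdotDl !rdotDr !rdotE (rdotC y x); nra.
Qed.

Lemma rdot_norm_le x y : `|rdot x y| <= nrm x * nrm y.
Proof. by rewrite ler_norml rdot_le lerNl -rdotNl -(nrmN x) rdot_le. Qed.

Lemma nrm_le_rdot x y : rdot x x <= rdot y y -> nrm x <= nrm y.
Proof. by rewrite !rdotE ler_sqr// nnegrE nrm_ge0. Qed.

Lemma rdot_nrm_le x y : nrm x <= nrm y -> rdot x x <= rdot y y.
Proof. by rewrite !rdotE ler_sqr// nnegrE nrm_ge0. Qed.

Lemma tends_rdot u l e y : tends u l -> 0 < e ->
  exists N : nat, forall n, (N <= n)%N -> `|rdot (u n) y - rdot l y| <= e.
Proof.
move=> ul e0.
have d0 : 0 < nrm y + 1 by rewrite ltr_wpDl// nrm_ge0.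
have [N HN] := ul (e / (nrm y + 1)) (divr_gt0 e0 d0).
exists N => n /HN h; rewrite -rdotNl -rdotDl (le_trans (rdot_norm_le _ _))//.
move: h; rewrite ler_pdivlMr// => h.
by have := nrm_ge0 (u n - l); nra.
Qed.

End InnerProduct.
End RealGeometry.

(** * A commutative algebra of symmetric operators *)

Section CommutingAlgebra.
Context {R : realType} {H : completeNormedModType R[i]}.

Definition commutes (F T : H -> H) := forall x, F (T x) = T (F x).

Variables (dot : {dot H for Num.conj}) (gens : set {linear H -> H}).
Implicit Types (F : H -> H) (c e : R).

Definition in_commutant F := forall g, gens g -> commutes F g.

(** The bounded symmetric operators which lie in the commutant of [gens] and
    commute with all of that commutant, including its maps that are only
    real-linear. The last condition has two uses: any two such operators
    commute, hence products of symmetric operators are symmetric and the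
    operators form a commutative ring; and every such operator commutes with
    each conjugation that commutes with [gens], so that everything constructed
    inside the algebra is J-real at no cost. *)
Record csa_spec (f : H -> H) : Prop := CsaSpec {
  csa_spec_linear : forall (a : R[i]) x y, f (a *: x + y) = a *: f x + f y;
  csa_spec_bounded : exists c, opnorm_le c f;
  csa_spec_sym : forall x y, rdot dot (f x) y = rdot dot x (f y);
  csa_spec_gens : in_commutant f;
  csa_spec_bicomm : forall F,
    bounded_additive F -> in_commutant F -> commutes F f }.

Record csaop := CsaOp { csa_fun :> H -> H; csaP : csa_spec csa_fun }.
Implicit Types (S T : csaop).

HB.instance Definition _ T :=
  GRing.isLinear.Build R[i] H H *:%R T (csa_spec_linear (csaP T)).

Lemma csa_inj S T : S =1 T -> S = T.
Proof.
case: S T => [f fP] [g gP] /= /funext fg; move: fP; rewrite fg => fP.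
by rewrite (Prop_irrelevance fP gP).
Qed.

Lemma csa_bounded T : exists c, opnorm_le c T.
Proof. by have [] := csaP T. Qed.

Lemma csa_bounded_additive T : bounded_additive T.
Proof. by split; [move=> x y; rewrite linearD|exact: csa_bounded]. Qed.

Lemma csa_sym T x y : rdot dot (T x) y = rdot dot x (T y).
Proof. by have [] := csaP T. Qed.

Lemma csa_commutes T F :
  bounded_additive F -> in_commutant F -> commutes F T.
Proof. by move=> Fb FC; exact: (csa_spec_bicomm (csaP T) Fb FC). Qed.

Lemma csaC S T x : S (T x) = T (S x).
Proof.
apply: csa_commutes; first exact: csa_bounded_additive.
exact: csa_spec_gens (csaP S).
Qed.

Let csa0_spec : csa_spec (fun=> 0).
Proof.
split=> [a x y||x y|g g_gens x|F Fb _ x].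
- by rewrite scaler0 addr0.
- by exists 0 => x; rewrite nrm0 mul0r.
- by rewrite /rdot linear0l linear0r.
- by rewrite linear0.
- by rewrite bounded_additive0.
Qed.

Let csaN_spec T : csa_spec (fun x => - T x).
Proof.
split=> [a x y||x y|g g_gens x|F Fb FC x].
- by rewrite linearP/= opprD scalerN.
- by have [c Tc] := csa_bounded T; exists c => x; rewrite nrmN.
- by rewrite rdotNl rdotNr csa_sym.
- by rewrite linearN/= (csa_spec_gens (csaP T)).
- by rewrite bounded_additiveN// (csa_commutes _ Fb FC).
Qed.

Let csaD_spec S T : csa_spec (fun x => S x + T x).
Proof.
split=> [a x y||x y|g g_gens x|F Fb FC x].
- by rewrite !linearP/= scalerDr addrACA.
- have [[c Sc] [d Td]] := (csa_bounded S, csa_bounded T).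
  by exists (c + d) => x; rewrite (opnorm_leD Sc Td).
- by rewrite rdotDl rdotDr !csa_sym.
- by rewrite linearD/= !(csa_spec_gens (csaP _) g_gens).
- by rewrite Fb.1 !(csa_commutes _ Fb FC).
Qed.

Let csa1_spec : csa_spec idfun.
Proof. by split=> //; exists 1; exact: opnorm_le1. Qed.

Let csaM_spec S T : csa_spec (S \o T).
Proof.
split=> [a x y||x y|g g_gens x|F Fb FC x] /=.
- by rewrite !linearP.
- have [[c Sc] [d Td]] := (csa_bounded S, csa_bounded T).
  exists (`|c| * d) => x; apply: (opnorm_leM _ (opnorm_leW (ler_norm c) Sc) Td).
  exact: normr_ge0.
- by rewrite !csa_sym csaC.
- by rewrite !(csa_spec_gens (csaP _) g_gens).
- by rewrite !(csa_commutes _ Fb FC).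
Qed.

Let half2 : 2^-1 + 2^-1 = 1 :> R.
Proof. lra. Qed.

(* Doubling reduces symmetry, and commutation with additive maps, to
   additivity. *)
Let csa_half_spec : csa_spec (fun x => (2^-1)%:C%C *: x).
Proof.
split=> [a x y||x y|g g_gens x|F Fb FC x].
- by rewrite scalerDr !scalerA mulrC.
- by exists 2^-1; exact: opnorm_le_half.
- have h z w : rdot dot ((2^-1)%:C%C *: z) w = 2^-1 * rdot dot z w.
    have {2}-> : z = 2^-1%:C%C *: z + 2^-1%:C%C *: z.
      by rewrite -scalerDl -rmorphD/= half2 scale1r.
    rewrite rdotDl; lra.
  by rewrite h [RHS]rdotC h rdotC.
- by rewrite linearZ.
- have e : F x = F (2^-1%:C%C *: x) + F (2^-1%:C%C *: x).
    by rewrite -Fb.1 -scalerDl -rmorphD/= half2 scale1r.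
  by rewrite e scalerDr -scalerDl -rmorphD/= half2 scale1r.
Qed.

HB.instance Definition _ := gen_eqMixin csaop.
HB.instance Definition _ := gen_choiceMixin csaop.

Definition csa_zero := CsaOp csa0_spec.
Definition csa_opp T := CsaOp (csaN_spec T).
Definition csa_add S T := CsaOp (csaD_spec S T).
Definition csa_one := CsaOp csa1_spec.
Definition csa_mul S T := CsaOp (csaM_spec S T).
Definition csa_half := CsaOp csa_half_spec.

Let addA : associative csa_add.
Proof. by move=> ? ? ?; apply: csa_inj => x /=; rewrite addrA. Qed.
Let addC : commutative csa_add.
Proof. by move=> ? ?; apply: csa_inj => x /=; rewrite addrC. Qed.
Let add0 : left_id csa_zero csa_add.
Proof. by move=> ?; apply: csa_inj => x /=; rewrite add0r. Qed.
Let addN : left_inverse csa_zero csa_opp csa_add.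
Proof. by move=> ?; apply: csa_inj => x /=; rewrite addNr. Qed.

HB.instance Definition _ := GRing.isZmodule.Build csaop addA addC add0 addN.

Let mulA : associative csa_mul.
Proof. by move=> ? ? ?; exact: csa_inj. Qed.
Let mulC : commutative csa_mul.
Proof. by move=> ? ?; apply: csa_inj => x; exact: csaC. Qed.
Let mul1 : left_id csa_one csa_mul.
Proof. by move=> ?; exact: csa_inj. Qed.
Let mulDl : left_distributive csa_mul csa_add.
Proof. by move=> ? ? ?; exact: csa_inj. Qed.

HB.instance Definition _ :=
  GRing.Zmodule_isComPzRing.Build csaop mulA mulC mul1 mulDl.

Lemma csaDE S T x : (S + T) x = S x + T x. Proof. by []. Qed.
Lemma csaNE T x : (- T) x = - T x. Proof. by []. Qed.
Lemma csaME S T x : (S * T) x = S (T x). Proof. by []. Qed.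
Lemma csa1E x : (1 : csaop) x = x. Proof. by []. Qed.
Lemma csa0E x : (0 : csaop) x = 0. Proof. by []. Qed.

Lemma csa_natE n x : (n%:R : csaop) x = n%:R *: x.
Proof.
elim: n => [|n IH]; first by rewrite scale0r.
by rewrite -!natr1 scalerDl scale1r csaDE IH.
Qed.

Lemma csa_half2 : csa_half + csa_half = 1.
Proof.
by apply: csa_inj => x /=; rewrite -scalerDl -rmorphD/= half2 scale1r.
Qed.

Lemma csa_nrm0 T : opnorm_le 0 T -> T = 0.
Proof.
move=> T0; apply: csa_inj => x; apply: nrm_eq0; apply/eqP.
by rewrite eq_le nrm_ge0 andbT (le_trans (T0 x))// mul0r.
Qed.

Hypothesis Hdot : induces_norm dot.
Hypothesis gens_bounded : forall g, gens g -> exists c, opnorm_le c g.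

(** Strong limits suffice: apart from boundedness, each defining condition of
    the algebra is an equation at given vectors in which the operator occurs
    linearly, so it passes to pointwise limits. *)
Lemma csa_strong_limit (T_ : nat -> csaop) c : (forall n, opnorm_le c (T_ n)) ->
  (forall x, exists l, tends (T_^~ x) l) ->
  exists T : csaop, forall x, tends (T_^~ x) (T x).
Proof.
move=> T_c /choice[f fl].
suff fP : csa_spec f by exists (CsaOp fP).
have comm F :
    bounded_additive F -> (forall n, commutes F (T_ n)) -> commutes F f.
  move=> Fb FT x; apply: (tends_unique _ (fl (F x))).
  by apply: (eq_tends _ (tends_bounded_additive Fb (fl x))) => n /=; rewrite FT.
split=> [a x y||x y|g g_gens x|F Fb FC].
- apply: (tends_unique (fl _)).
  have h :=
    tendsD (tends_bounded_additive (scaler_bounded_additive a) (fl x)) (fl y).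
  by apply: (eq_tends _ h) => n /=; rewrite linearP.
- exists c => x; rewrite -[f x]subr0; apply: (tends_nrm_le (N := 0%N) (fl x)).
  by move=> n _; rewrite subr0; exact: T_c.
- apply/eqP; rewrite -subr_eq0 -normr_eq0 eq_le normr_ge0 andbT.
  apply: le_eps => e e0; rewrite add0r.
  have e20 : 0 < e / 2 by rewrite divr_gt0.
  have [N HN] := tends_rdot Hdot y (fl x) e20.
  have [M HM] := tends_rdot Hdot x (fl y) e20.
  have := HM (maxn N M) (leq_maxr _ _).
  have := HN (maxn N M) (leq_maxl _ _).
  rewrite csa_sym (rdotC _ (T_ _ y)) (rdotC _ (f y)) distrC => h1 h2.
  rewrite (le_trans (ler_distD (rdot dot x (T_ (maxn N M) y)) _ _))//.
  lra.
- rewrite -comm//; last first.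
    by move=> n z; rewrite (csa_spec_gens (csaP (T_ n)) g_gens).
  by split; [move=> z w; rewrite linearD|exact: gens_bounded].
- by apply: comm => // n x; rewrite (csa_commutes _ Fb FC).
Qed.

Lemma csa_norm_limit (T_ : nat -> csaop) (e : nat -> R) :
  (forall m n, (m <= n)%N -> opnorm_le (e m) (T_ n - T_ m)) ->
  (forall d, 0 < d -> exists N : nat, forall n, (N <= n)%N -> e n <= d) ->
  exists T : csaop, forall m, opnorm_le (e m) (T - T_ m).
Proof.
move=> Te e0; have [c T0c] := csa_bounded (T_ 0%N).
have T_c n : opnorm_le (e 0%N + c) (T_ n).
  have := opnorm_leD (Te 0%N n (leq0n _)) T0c.
  by move=> h x; have := h x; rewrite csaDE csaNE subrK.
have [x|T HT] := csa_strong_limit T_c.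
  apply: cauchy_tends => d d0.
  have x1 : 0 < nrm x + 1 by rewrite ltr_wpDl// nrm_ge0.
  have [N HN] := e0 _ (divr_gt0 d0 x1); exists N => m n /andP[Nm mn].
  rewrite (le_trans (Te m n mn x))//.
  have := HN m Nm; rewrite ler_pdivlMr// => h.
  have := nrm_ge0 x; have := nrm_ge0 ((T_ n - T_ m) x).
  by have := Te m n mn x; nra.
exists T => m x; rewrite csaDE csaNE.
apply: (tends_nrm_le (N := m) (HT x)) => n mn.
by rewrite -csaNE -csaDE (Te _ _ mn).
Qed.

End CommutingAlgebra.

(** * Square roots, signs and square roots of unitary operators *)

Section Roots.
Context {R : realType} {H : completeNormedModType R[i]}.
Variables (dot : {dot H for Num.conj}) (gens : set {linear H -> H}).
Hypothesis Hdot : induces_norm dot.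
Hypothesis gens_bounded : forall g, gens g -> exists c, opnorm_le c g.
Local Notation csaop := (csaop dot gens).
Local Notation half := (csa_half dot gens).
Implicit Types (B C D G M P Q S T X Y Z : csaop) (c d e : R).

Lemma csa_leD c d S T :
  opnorm_le c S -> opnorm_le d T -> opnorm_le (c + d) (S + T).
Proof. exact: opnorm_leD. Qed.

Lemma csa_leN c T : opnorm_le c T -> opnorm_le c (- T).
Proof. exact: opnorm_leN. Qed.

Lemma csa_leM c d S T : 0 <= c ->
  opnorm_le c S -> opnorm_le d T -> opnorm_le (c * d) (S * T).
Proof. exact: opnorm_leM. Qed.

Lemma csa_le_half c T : opnorm_le c T -> opnorm_le (2^-1 * c) (half * T).
Proof. by move=> Tc; apply: csa_leM => //; exact: opnorm_le_half. Qed.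

Lemma csa_leX c T n : 0 <= c -> opnorm_le c T -> opnorm_le (c ^+ n) (T ^+ n).
Proof.
move=> c0 Tc; elim: n => [|n IH]; first by rewrite !expr0; exact: opnorm_le1.
by rewrite !exprS; exact: csa_leM.
Qed.

Lemma nonincreasing_cauchy (a : nat -> R) :
  (forall n, 0 <= a n) -> (forall n, a n.+1 <= a n) -> forall e, 0 < e ->
  exists N : nat, forall m n, (N <= m)%N -> a m - a n <= e.
Proof.
move=> a0 aS e e0.
have a_inf : has_inf (range a).
  by split; [exists (a 0%N), 0%N|exists 0 => _ [n _ <-]].
have [_ [N _ <-] aN] := inf_adherent e0 a_inf.
exists N => m n Nm.
have am : a m <= a N.
  move: Nm => /subnK <-; elim: (m - N)%N => [//|k IH].
  by rewrite addSn (le_trans (aS _)).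
have : inf (range a) <= a n by apply: ge_inf; [exact: a_inf.2|exists n].
lra.
Qed.

Lemma csa_le0 : opnorm_le 0 (0 : csaop).
Proof. by move=> x; rewrite csa0E nrm0 mul0r. Qed.

Lemma csa_le_eps c T :
  (forall e, 0 < e -> opnorm_le (c + e) T) -> opnorm_le c T.
Proof.
move=> Tc x; apply: le_eps => e e0.
have x1 : 0 < nrm x + 1 by rewrite ltr_wpDl// nrm_ge0.
rewrite (le_trans (Tc _ (divr_gt0 e0 x1) x))// mulrDl lerD2l.
by rewrite mulrAC ler_pdivrMr// ler_pM2l// lerDl.
Qed.

Lemma csa_telescope_limit (T_ : nat -> csaop) (a : nat -> R) :
  (forall n, opnorm_le (a n - a n.+1) (T_ n.+1 - T_ n)) ->
  (forall n, 0 <= a n) ->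
  (forall d, 0 < d -> exists N : nat, forall n, (N <= n)%N -> a n <= d) ->
  exists T, forall m, opnorm_le (a m) (T - T_ m).
Proof.
move=> dT a0; apply: csa_norm_limit => // m n /subnK <-.
apply: (@opnorm_leW _ _ (a m - a (n - m + m)%N)); first by rewrite gerBl.
elim: (n - m)%N => [|k IH]; first by rewrite !subrr; exact: csa_le0.
rewrite addSn -(subrKA (T_ (k + m)%N)) -(subrKA (a (k + m)%N)).
rewrite [X in opnorm_le X]addrC.
exact: csa_leD.
Qed.

(** A square root [1 - Y] of [1 - X] amounts to a fixed point of
    [Y |-> (X + Y ^ 2) / 2], reached by iteration from [0]. The norms of the
    iterates and of their increments are dominated by the corresponding numbers
    [y_k] for [X = 1], and these increase to [1]; hence convergence in norm even
    when [1 - X] is not invertible. When [`|X| <= c <= 1 / 2], the ball of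
    radius [2 / 3 * c] is stable under the iteration. *)
Lemma csa_sqrt X : opnorm_le 1 X ->
  exists Y, [/\ (1 - Y) * (1 - Y) = 1 - X, opnorm_le 1 Y &
    forall c, c <= 2^-1 -> opnorm_le c X -> opnorm_le (2 / 3 * c) Y].
Proof.
move=> X1; have h2 := csa_half2 dot gens.
have [Y_ [Y_0 Y_S]] : exists Y_ : nat -> csaop,
    Y_ 0%N = 0 /\ forall k, Y_ k.+1 = half * (X + Y_ k * Y_ k).
  by exists (fun k => iter k (fun Y => half * (X + Y * Y)) 0).
have [y_ [y_0 y_S]] : exists y_ : nat -> R,
    y_ 0%N = 0 /\ forall k, y_ k.+1 = 2^-1 * (1 + y_ k * y_ k).
  by exists (fun k => iter k (fun y => 2^-1 * (1 + y * y)) 0).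
have y0 k : 0 <= y_ k.
  case: k => [|k]; first by rewrite y_0.
  by rewrite y_S; have := sqr_ge0 (y_ k); rewrite expr2; lra.
have Yy k : opnorm_le (y_ k) (Y_ k).
  elim: k => [|k IH]; first by rewrite Y_0 y_0; exact: csa_le0.
  rewrite Y_S y_S; apply: csa_le_half; apply: csa_leD => //; exact: csa_leM.
have dYy k : opnorm_le (y_ k.+1 - y_ k) (Y_ k.+1 - Y_ k).
  elim: k => [|k IH].
    by have := Yy 1%N; rewrite Y_0 y_0 !subr0.
  have -> : Y_ k.+2 - Y_ k.+1 =
      half * ((Y_ k.+1 + Y_ k) * (Y_ k.+1 - Y_ k)).
    by rewrite Y_S [X in _ - X](Y_S k); ring.
  have -> : y_ k.+2 - y_ k.+1 =
      2^-1 * ((y_ k.+1 + y_ k) * (y_ k.+1 - y_ k)).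
    by rewrite y_S [X in _ - X](y_S k); ring.
  apply: csa_le_half; apply: csa_leM => //; first by rewrite addr_ge0.
  exact: csa_leD.
(* The rate comes from [1 - y_k.+1 = e - e ^ 2 / 2] with [e = 1 - y_k]. *)
have e_le k : 1 - y_ k <= 2 / k.+2%:R.
  elim: k => [|k IH]; first by rewrite y_0 divff// subr0.
  move: IH; rewrite !ler_pdivlMr ?ltr0n// y_S -(addn3 k) -(addn2 k) !natrD.
  have := y0 k; have : (0 : R) <= k%:R by [].
  move: (y_ k) (k%:R : R) => y t t0 y0' IH.
  have : 0 <= (2 - (1 - y) * (t + 2)) * (1 + y).
    by apply: mulr_ge0; lra.
  have := sqr_ge0 (1 - y). nra.
have y1 k : y_ k <= 1.
  elim: k => [|k IH]; first by rewrite y_0.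
  rewrite y_S; have := y0 k; nra.
have e_small d : 0 < d -> exists N : nat, forall n, (N <= n)%N -> 1 - y_ n <= d.
  move=> d0; pose N := Num.truncn (2 / d); exists N => n Nn.
  rewrite (le_trans (e_le n))// ler_pdivrMr ?ltr0n//.
  rewrite mulrC -ler_pdivrMr//.
  have /ltW/le_trans : 2 / d < N.+1%:R by rewrite truncnS_gt.
  by apply; rewrite ler_nat ltnS leqW.
have [k|k|Y HY] := csa_telescope_limit (T_ := Y_) _ _ e_small.
- by rewrite opprB addrC addrA subrK; exact: dYy.
- by rewrite subr_ge0.
have le_lim c : (forall k, opnorm_le c (Y_ k)) -> opnorm_le c Y.
  move=> Yc; apply: csa_le_eps => e /e_small[N /(_ N (leqnn _)) eN].
  rewrite -(subrK (Y_ N) Y) addrC; apply: csa_leD => //.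
  exact: opnorm_leW eN (HY N).
have Y1 : opnorm_le 1 Y by apply: le_lim => k; apply: opnorm_leW (Yy k).
exists Y; split=> //.
- suff : Y + Y - X - Y * Y = 0.
    move=> YX; have -> : X = Y + Y - Y * Y - (Y + Y - X - Y * Y) by ring.
    by rewrite YX; ring.
  apply: csa_nrm0; apply: csa_le_eps => e e0; rewrite add0r.
  have /e_small[N HN] : 0 < e / 4 by rewrite divr_gt0.
  have -> : Y + Y - X - Y * Y =
      (Y - Y_ N.+1) + (Y - Y_ N.+1) - (Y - Y_ N) * (Y + Y_ N).
    rewrite addrACA -opprD Y_S -mulrDl h2; ring.
  have h k : (N <= k)%N -> opnorm_le (e / 4) (Y - Y_ k).
    by move=> /HN Nk; exact: opnorm_leW Nk (HY k).
  have -> : e = e / 4 + e / 4 + (e / 4) * (1 + 1) by field.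
  apply: csa_leD; first by apply: csa_leD; exact: h.
  apply: csa_leN; apply: csa_leM; rewrite ?divr_ge0 ?ltW//; first exact: h.
  by apply: csa_leD => //; apply: opnorm_leW (Yy N).
- move=> c c2 Xc; have [c0|c0] := leP 0 c; last first.
    move=> x; have := le_trans (nrm_ge0 _) (Xc x).
    rewrite nmulr_rge0// => x0; have -> : x = 0.
      by apply: nrm_eq0; apply/eqP; rewrite eq_le x0 nrm_ge0.
    by rewrite linear0 nrm0 mulr0.
  apply: le_lim; elim=> [|k IH].
    rewrite Y_0; apply: opnorm_leW csa_le0; lra.
  rewrite Y_S; have c1 : 0 <= 2 / 3 * c by lra.
  apply: opnorm_leW (csa_le_half (csa_leD Xc (csa_leM c1 IH IH))).
  nra.
Qed.

Lemma csa_rdot_mul S T x y : rdot dot (S x) (T y) = rdot dot ((S * T) x) y.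
Proof. by rewrite -csa_sym (mulrC S). Qed.

Lemma csa_le1_rdot T : opnorm_le 1 T ->
  forall x, rdot dot (T x) (T x) <= rdot dot x x.
Proof.
by move=> T1 x; apply: rdot_nrm_le => //; rewrite (le_trans (T1 x))// mul1r.
Qed.

(** For a symmetric contraction [Q], the squared norms of the powers [Q ^ k x]
    decrease. By symmetry the squared distance between [Q ^ (2 n) x] and
    [Q ^ (2 m) x] is a combination of differences of these numbers, so the even
    powers converge strongly. The limit is the projection onto the fixed
    vectors of [Q ^ 2]. *)
Lemma csa_power_limit Q : opnorm_le 1 Q -> exists P, [/\ P * P = P,
  Q * Q * P = P & forall Z, Q * Z = Z -> P * Z = Z].
Proof.
move=> Q1; pose T_ n := Q ^+ (n + n).
have Qn1 n : opnorm_le 1 (Q ^+ n).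
  by rewrite -(expr1n _ n); exact: csa_leX.
have [x|P HP] := csa_strong_limit Hdot gens_bounded (fun n => Qn1 (n + n)%N).
  pose a n := rdot dot ((Q ^+ n : csaop) x) ((Q ^+ n : csaop) x).
  have a0 n : 0 <= a n by rewrite /a rdotE// sqr_ge0.
  have aS n : a n.+1 <= a n.
    by rewrite /a exprS !csaME; exact: csa_le1_rdot.
  apply: cauchy_tends => e e0.
  have e20 : 0 < e ^+ 2 / 2 by rewrite divr_gt0 ?exprn_gt0.
  have [N HN] := nonincreasing_cauchy a0 aS e20.
  exists N => m n /andP[Nm mn].
  have Nm2 : (N <= m + m)%N by rewrite (leq_trans Nm)// leq_addr.
  have Nmn : (N <= n + m)%N by rewrite (leq_trans Nm)// leq_addl.
  have Nn2 : (N <= n + n)%N by rewrite (leq_trans (leq_trans Nm mn))// leq_addr.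
  rewrite -ler_sqr ?nnegrE ?nrm_ge0 ?(ltW e0)// -(rdotE Hdot).
  rewrite rdotDl !rdotDr !rdotNl !rdotNr opprK !csa_rdot_mul -!exprD.
  have aE i j k : (i + j = k + k)%N ->
      rdot dot ((Q ^+ (i + j) : csaop) x) x = a k.
    by move=> ->; rewrite /a csa_rdot_mul exprD.
  rewrite (aE _ _ (n + n)%N)// (aE _ _ (n + m)%N); last by rewrite addnACA.
  rewrite (aE (m + m)%N (m + m)%N (m + m)%N)// (aE (m + m)%N _ (n + m)%N).
    by have := HN _ (n + m)%N Nm2; have := HN _ (n + m)%N Nn2; lra.
  by rewrite addnACA (addnC m n).
have TS n : T_ n.+1 = Q * Q * T_ n by rewrite /T_ addSn addnS !exprS mulrA.
have fix_lim Z : Q * Q * Z = Z -> P * Z = Z.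
  move=> QZ; apply: csa_inj => x; rewrite csaME.
  apply: (tends_unique (HP _)) => e e0; exists 0%N => n _.
  rewrite -csaME (_ : _ * Z = Z) ?subrr ?nrm0 ?ltW//.
  elim: n => [|n IH]; first by rewrite expr0 mul1r.
  by rewrite [X in X * Z]TS mulrAC QZ mulrC.
have QP : Q * Q * P = P.
  apply: csa_inj => x; apply: (tends_unique _ (HP x)).
  have := tends_bounded_additive (csa_bounded_additive (Q * Q)) (HP x).
  move=> h e /h[N HN]; exists N.+1 => -[//|n] Nn.
  by rewrite [X in csa_fun X x]TS; exact: HN.
by exists P; split=> // [|Z QZ]; apply: fix_lim => //; rewrite -mulrA QZ.
Qed.

(** Pairing the equation with [x] gives
    [2 |T x| ^ 2 = |T T x| ^ 2 <= |T x| ^ 2]. *)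
Lemma csa_contraction_eq0 T x : opnorm_le 1 T ->
  T (T (T (T x))) = T (T x) + T (T x) -> T x = 0.
Proof.
move=> T1 Tx.
have h : rdot dot (T (T (T (T x)))) x = rdot dot (T (T x) + T (T x)) x.
  by rewrite Tx.
have := csa_le1_rdot T1 (T x).
move: h; rewrite rdotDl 2!csa_sym (csa_sym T (T x) x) => h1 h2.
apply: nrm_eq0; apply/eqP; rewrite -sqrf_eq0 -(rdotE Hdot); apply/eqP.
have : 0 <= rdot dot (T x) (T x) by rewrite rdotE// sqr_ge0.
lra.
Qed.

(** A symmetry [G] plays the role of the sign of [M D]. With [P] the projection
    onto the kernel of [M - D], take [G = 2 P - 1]: on that kernel [M = D], and
    since [(M - D) (M + D) = 0] the range of [M + D] lies in the kernel, so
    [M = - D] on its orthogonal complement. Here [P] is the strong limit of the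
    even powers of [1 - B ^ 2], where [B = (M - D) / 2]. *)
Lemma csa_sign M D : opnorm_le 1 M -> opnorm_le 1 D -> M * M = D * D ->
  exists G, G * G = 1 /\ G * D = M.
Proof.
move=> M1 D1 MD; have h2 := csa_half2 dot gens.
pose B := half * (M - D).
have BB : B + B = M - D by rewrite -mulrDl h2 mul1r.
have B1 : opnorm_le 1 B.
  by apply: opnorm_leW (csa_le_half (csa_leD M1 (csa_leN D1))); lra.
have Q1 : opnorm_le 1 (1 - B * B).
  move=> x; rewrite mul1r; apply: (nrm_le_rdot Hdot).
  have := csa_le1_rdot B1 (B x).
  have : 0 <= rdot dot (B x) (B x) by rewrite rdotE// sqr_ge0.
  rewrite csaDE csaNE csaME csa1E rdotDl !rdotDr !rdotNl !rdotNr.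
  rewrite (csa_sym B (B x) x) -(csa_sym B x); lra.
have [P [PP QP fixP]] := csa_power_limit Q1.
have BP : B * P = 0.
  apply: csa_inj => x; rewrite csaME; apply: csa_contraction_eq0 => //.
  have E : B * (B * (B * (B * P))) = B * (B * P) + B * (B * P).
    have -> : B * (B * (B * (B * P))) = B * (B * P) + B * (B * P) +
        ((1 - B * B) * (1 - B * B) * P - P) by ring.
    by rewrite QP subrr addr0.
  exact: (congr1 (fun T : csaop => T x) E).
have NP : (M - D) * P = 0 by rewrite -BB mulrDl BP addr0.
have PN : P * (M + D) = M + D.
  apply: fixP; rewrite mulrBl mul1r.
  have -> : B * B * (M + D) = half * B * (M * M - D * D) by rewrite /B; ring.
  by rewrite MD subrr mulr0 subr0.
exists (P + P - 1); split.
  have -> : (P + P - 1) * (P + P - 1) = 1 + (P * P - P) * 4%:R by ring.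
  by rewrite PP subrr mul0r addr0.
have -> : (P + P - 1) * D = P * (M + D) - (M - D) * P - D by ring.
by rewrite NP PN subr0 addrK.
Qed.

Lemma circle_le1 C D : C * C + D * D = 1 -> opnorm_le 1 C.
Proof.
move=> CD x; rewrite mul1r; apply: (nrm_le_rdot Hdot).
have -> : rdot dot x x = rdot dot (C x) (C x) + rdot dot (D x) (D x).
  by rewrite !csa_rdot_mul -rdotDl -csaDE CD.
by rewrite lerDl rdotE// sqr_ge0.
Qed.

(** Half-angle formulas. The operators [A] and [B] with
    [A ^ 2 = (1 + C) / 2] and [B ^ 2 = (1 - C) / 2] are the absolute values of
    the cosine and the sine of the half angle, and [(2 A B) ^ 2 = D ^ 2]; the
    symmetry [G] with [G (2 A B) = D] corrects the sign of the sine. The last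
    bound says that half an angle has a cosine at least three times closer to
    [1], as soon as the angle has nonnegative cosine. *)
Lemma circle_sqrt C D : C * C + D * D = 1 -> exists C' D',
  [/\ C' * C' + D' * D' = 1, C' * C' - D' * D' = C, C' * D' + C' * D' = D,
      opnorm_le 1 (1 - C') &
      forall c, c <= 1 -> opnorm_le c (1 - C) -> opnorm_le (c / 3) (1 - C')].
Proof.
move=> CD; have h2 := csa_half2 dot gens.
have C1 := circle_le1 CD.
have D1 : opnorm_le 1 D by apply: (@circle_le1 _ C); rewrite addrC.
have half1 T : opnorm_le 1 T -> opnorm_le 1 (half * (1 + T)).
  move=> T1.
  have := csa_le_half
    (csa_leD (opnorm_le1 (H := H) : opnorm_le 1 (1 : csaop)) T1).
  by apply: opnorm_leW; lra.
have [Y [YE Y1 Yc]] := csa_sqrt (half1 _ (csa_leN C1)).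
have [Z [ZE _ _]] := csa_sqrt (half1 _ C1).
pose A := 1 - Y; pose B := 1 - Z.
have AA : A * A = half * (1 + C).
  by rewrite YE -[X in X - _ = _]h2; ring.
have BB : B * B = half * (1 - C).
  by rewrite ZE -[X in X - _ = _]h2; ring.
have MM : (A * B + A * B) * (A * B + A * B) = D * D.
  have -> : (A * B + A * B) * (A * B + A * B) = A * A * (B * B) * 4%:R by ring.
  rewrite AA BB; have -> : half * (1 + C) * (half * (1 - C)) * 4%:R =
      (half + half) * (half + half) * (1 - C * C) by ring.
  by rewrite h2 !mul1r -CD addrC addKr.
have M1 : opnorm_le 1 (A * B + A * B).
  by apply: (@circle_le1 _ C); rewrite MM addrC.
have [G [GG GM]] := csa_sign D1 M1 (esym MM).
exists A, (G * B); split.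
- have -> : G * B * (G * B) = G * G * (B * B) by ring.
  rewrite GG AA BB mul1r.
  have -> : half * (1 + C) + half * (1 - C) = half + half by ring.
  exact: h2.
- have -> : G * B * (G * B) = G * G * (B * B) by ring.
  rewrite GG AA BB mul1r.
  have -> : half * (1 + C) - half * (1 - C) = (half + half) * C by ring.
  by rewrite h2 mul1r.
- by rewrite -GM; ring.
- by rewrite /A opprB addrCA subrr addr0.
- move=> c c1 Cc.
  rewrite /A opprB addrCA subrr addr0.
  rewrite (_ : c / 3 = 2 / 3 * (2^-1 * c)); last by field.
  apply: Yc; first lra.
  exact: csa_le_half.
Qed.

End Roots.

(** * The exponential as a limit of powers *)

Section CompoundInterest.
Context {R : realType}.
Implicit Types (c s t : R) (N : nat).

Lemma bernoulli_ineq s N : s <= 1 -> 1 - N%:R * s <= (1 - s) ^+ N.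
Proof.
move=> s1; elim: N => [|N IH]; first by rewrite mul0r subr0 expr0.
rewrite exprS; have s0 : 0 <= 1 - s by rewrite subr_ge0.
apply: (le_trans _ (ler_wpM2l s0 IH)); rewrite -natr1.
have : 0 <= N%:R * s ^+ 2 by rewrite mulr_ge0 ?sqr_ge0.
lra.
Qed.

(** With [t = c / N]: from [1 - t <= e ^ (- t)] one gets
    [1 + t >= e ^ t (1 - t ^ 2)]; raise this to the power [N]. *)
Lemma expR_sub_compound c N : 0 <= c -> (0 < N)%N ->
  expR c - (1 + c / N%:R) ^+ N <= expR c * c ^+ 2 / N%:R.
Proof.
move=> c0 N0; have N0' : 0 < N%:R :> R by rewrite ltr0n.
set t := c / N%:R.
have cE : c = N%:R * t by rewrite /t mulrCA divff ?mulr1 ?gt_eqF.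
have t0 : 0 <= t by rewrite divr_ge0 // ler0n.
have -> : expR c * c ^+ 2 / N%:R = expR c * (N%:R * t ^+ 2).
  by rewrite {2}cE; field; rewrite gt_eqF.
rewrite lerBlDr -lerBlDl.
have [s1|s1] := leP (t ^+ 2) 1; last first.
  apply: (@le_trans _ _ 0); last by rewrite exprn_ge0// addr_ge0.
  rewrite -{1}[expR c]mulr1 -mulrBr mulr_ge0_le0 ?expR_ge0// subr_le0.
  have : 1 <= N%:R :> R by rewrite ler1n.
  by move: s1; nra.
rewrite -{1}[expR c]mulr1 -mulrBr.
apply: (le_trans (ler_wpM2l (expR_ge0 c) (bernoulli_ineq N s1))).
rewrite {1}cE expRM_natl -exprMn.
rewrite lerXn2r ?nnegrE ?addr_ge0 ?mulr_ge0 ?expR_ge0 ?subr_ge0//.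
have -> : 1 - t ^+ 2 = (1 + t) * (1 - t) by ring.
rewrite mulrCA -[leRHS]mulr1 ler_wpM2l ?addr_ge0//.
have := expR_ge1Dx (- t); rewrite expRN => h.
by rewrite mulrC -ler_pdivlMr ?expR_gt0// div1r.
Qed.

Lemma bin_div_expn_le N k : 'C(N, k)%:R / N%:R ^+ k <= (k`!%:R)^-1 :> R.
Proof.
have [N0|N0] := posnP N.
  case: k => [|k]; first by rewrite N0 bin0 expr0 fact0 divr1 invr1.
  by rewrite N0 bin0n/= mul0r invr_ge0.
rewrite ler_pdivrMr ?exprn_gt0 ?ltr0n// mulrC ler_pdivlMr ?ltr0n ?fact_gt0//.
rewrite -natrM -natrX ler_nat bin_ffact.
by elim: k => [|k IH] //; rewrite ffactnSr expnSr leq_mul// leq_subr.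
Qed.

Lemma series_exp_coeff_le c n : 0 <= c -> series (exp_coeff c) n <= expR c.
Proof.
move=> c0; apply: nondecreasing_cvgn_le; last exact: is_cvg_series_exp_coeff.
by apply: nondecreasing_series => k _ _; exact: exp_coeff_ge0.
Qed.

Lemma geometric_small (K d : R) : 0 < d ->
  exists N : nat, forall n, (N <= n)%N -> K * (2 / 3) ^+ n <= d.
Proof.
move=> d0; have K0 : 0 < `|K| + 1 by rewrite ltr_wpDl.
have q1 : `|2 / 3 : R| < 1 by rewrite ger0_norm; lra.
have [N _ HN] : \forall n \near \oo, `|0 - (2 / 3) ^+ n| <= d / (`|K| + 1).
  exact: cvgr_dist_le (cvg_expr q1) _ (divr_gt0 d0 K0).
have q0 n : 0 <= (2 / 3) ^+ n :> R by apply: exprn_ge0; lra.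
exists N => n /HN; rewrite sub0r normrN ger0_norm// ler_pdivlMr// mulrC.
by apply: le_trans; rewrite ler_wpM2r// (le_trans (ler_norm K))// lerDl.
Qed.

End CompoundInterest.

Section Exponential.
Context {R : realType} {H : completeNormedModType R[i]}.
Implicit Types (T : {linear H -> H}) (x y : H) (c : R) (E W : H -> H).

Lemma iter_linear_binomial T (t : R[i]) j x :
  iter j (fun y => y + t *: T y) x =
  \sum_(k < j.+1) ('C(j, k)%:R * t ^+ k) *: iter k T x.
Proof.
elim: j => [|j IH]; first by rewrite big_ord1 bin0 expr0 mulr1 scale1r.
rewrite iterS IH linear_sum/= scaler_sumr [RHS]big_ord_recl/= bin0 expr0.
rewrite mulr1 scale1r big_ord_recl/= bin0 expr0 mulr1 scale1r -addrA.
congr (_ + _).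
have -> : \sum_(i < j) ('C(j, bump 0 i)%:R * t ^+ bump 0 i) *: T (iter i T x) =
    \sum_(i < j.+1) ('C(j, i.+1)%:R * t ^+ i.+1) *: iter i.+1 T x.
  by rewrite [RHS]big_ord_recr/= bin_small// mul0r scale0r addr0.
rewrite -big_split/=; apply: eq_bigr => i _.
rewrite linearZ scalerA -scalerDl; congr (_ *: _).
by rewrite /bump/= add1n binS natrD exprS; ring.
Qed.

Lemma opnorm_le_iter c (f : H -> H) k : 0 <= c ->
  opnorm_le c f -> opnorm_le (c ^+ k) (iter k f).
Proof.
move=> c0 fc; elim: k => [|k IH] x; first by rewrite expr0 mul1r.
by rewrite iterS (le_trans (fc _))// exprS -mulrA ler_wpM2l.
Qed.

Lemma nrm_sum (I : Type) (r : seq I) (F : I -> H) :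
  nrm (\sum_(i <- r) F i) <= \sum_(i <- r) nrm (F i).
Proof.
elim: r => [|a r IH]; first by rewrite !big_nil nrm0.
by rewrite !big_cons (le_trans (nrmD _ _))// lerD2l.
Qed.

(** The coefficient of [T ^ k] in the partial exponential sum exceeds the one in
    [(1 + T / N) ^ N], so the difference is dominated by its value at the number
    [c], which [expR_sub_compound] estimates. *)
Lemma op_exp_compound T c N x : 0 <= c -> opnorm_le c T -> (0 < N)%N ->
  nrm (series (op_exp_coeff T x) N.+1 -
       iter N (fun y => y + (N%:R)^-1 *: T y) x) <=
  expR c * c ^+ 2 / N%:R * nrm x.
Proof.
move=> c0 Tc N0; rewrite iter_linear_binomial /series/= big_mkord -sumrB.
apply: (le_trans (nrm_sum _ _)).
pose b k : R := (k`!%:R)^-1 - 'C(N, k)%:R / N%:R ^+ k.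
have -> : \sum_(k < N.+1) nrm (op_exp_coeff T x k -
      ('C(N, k)%:R * N%:R^-1 ^+ k) *: iter k T x) =
    \sum_(k < N.+1) b k * nrm (iter k T x).
  apply: eq_bigr => k _; rewrite /op_exp_coeff -scalerBl.
  have -> : (k`!%:R)^-1 - 'C(N, k)%:R * N%:R^-1 ^+ k = (b k)%:C%C.
    by rewrite /b rmorphB rmorphM !fmorphV/= rmorphXn/= !rmorph_nat exprVn.
  by rewrite nrmZr ger0_norm// subr_ge0 bin_div_expn_le.
apply: (@le_trans _ _ (\sum_(k < N.+1) b k * (c ^+ k * nrm x))).
  apply: ler_sum => k _; apply: ler_wpM2l.
    by rewrite subr_ge0 bin_div_expn_le.
  exact: opnorm_le_iter.
rewrite (eq_bigr (fun k : 'I_N.+1 => b k * c ^+ k * nrm x)); last first.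
  by move=> k _; rewrite mulrA.
rewrite -mulr_suml ler_wpM2r ?nrm_ge0//.
apply: le_trans (expR_sub_compound c0 N0).
have -> : \sum_(k < N.+1) b k * c ^+ k =
    series (exp_coeff c) N.+1 - (1 + c / N%:R) ^+ N.
  rewrite exprDn /series/= big_mkord -sumrB; apply: eq_bigr => k _.
  rewrite expr1n mul1r /b mulrBl /exp_coeff/= mulrC; congr (_ - _).
  by rewrite -[RHS]mulr_natl exprMn exprVn; ring.
by rewrite lerB// series_exp_coeff_le.
Qed.

(** Telescoping over the [n] places where a factor [E] is replaced by [W]. *)
Lemma iter_dist_le E W (b d : R) n x : bounded_additive E -> 1 <= b -> 0 <= d ->
  opnorm_le b E -> opnorm_le 1 W -> (forall y, nrm (E y - W y) <= d * nrm y) ->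
  nrm (iter n E x - iter n W x) <= n%:R * d * b ^+ n * nrm x.
Proof.
move=> Eb b1 d0 E_b W1 EW; elim: n => [|n IH].
  by rewrite subrr nrm0 !mul0r.
rewrite !iterS (le_trans (nrm_triangle (E (iter n W x)) _ _))//.
rewrite -bounded_additiveB//.
have b0 : 0 <= b by lra.
have h1 := le_trans (E_b _) (ler_wpM2l b0 IH).
have Wn : nrm (iter n W x) <= nrm x.
  by have := opnorm_le_iter n ler01 W1 x; rewrite expr1n mul1r.
have h2 := le_trans (EW _) (ler_wpM2l d0 Wn).
apply: (le_trans (lerD h1 h2)).
have h3 : d * nrm x <= d * nrm x * b ^+ n.+1.
  by rewrite ler_peMr ?exprn_ege1// mulr_ge0 ?nrm_ge0.
rewrite -natr1 exprS; move: h3; rewrite exprS; lra.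
Qed.

End Exponential.

(** * Logarithms of unitary operators *)

Section Rotation.
Context {R : realType} {H : completeNormedModType R[i]}.
Variables (dot : {dot H for Num.conj}) (gens : set {linear H -> H}).
Hypothesis Hdot : induces_norm dot.
Hypothesis gens_bounded : forall g, gens g -> exists c, opnorm_le c g.
Local Notation csaop := (csaop dot gens).
Implicit Types (C D S T : csaop) (x y : H).

Lemma nrm_i x : nrm ('i *: x) = nrm x.
Proof. by rewrite nrmZ normCi mul1r. Qed.

Lemma rdot_i x y : rdot dot ('i *: x) y = - rdot dot x ('i *: y).
Proof.
by rewrite /rdot linearZl_LR linearZr_LR/= conjCi mulNr raddfN opprK.
Qed.

(** For a symmetric operator [T] the number [dot (T x) x] is real. *)
Lemma rdot_i_sym T x : rdot dot x ('i *: T x) = 0.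
Proof.
have : rdot dot x ('i *: T x) = - rdot dot x ('i *: T x).
  by rewrite -[in RHS]linearZ/= -(csa_sym T x) -rdot_i rdotC.
lra.
Qed.

(** With [C] and [D] in the algebra and [C ^ 2 + D ^ 2 = 1], this is the unitary
    operator with real part [C] and imaginary part [D]. *)
Definition rotation C D x : H := C x + 'i *: D x.

(** The cross term of [`|C x + i D x| ^ 2] vanishes by [rdot_i_sym]. *)
Lemma rotation_le1 C D : C * C + D * D = 1 -> opnorm_le 1 (rotation C D).
Proof.
move=> CD x; rewrite mul1r; apply: (nrm_le_rdot Hdot).
have CiD : rdot dot (C x) ('i *: D x) = 0.
  by rewrite csa_sym linearZ/= -csaME rdot_i_sym.
rewrite rdotDl !rdotDr (rdotC _ _ (C x)) CiD (rdotE Hdot ('i *: _)) nrm_i.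
rewrite addr0 add0r -!(rdotE Hdot) !csa_rdot_mul -rdotDl -csaDE CD.
exact: lexx.
Qed.

Lemma rotationM C D C' D' x : rotation C D (rotation C' D' x) =
  rotation (C * C' - D * D') (C * D' + D * C') x.
Proof.
rewrite /rotation !linearD/= !linearZ/= scalerA -expr2 sqrCi scaleN1r.
by rewrite [X in _ + X = _]addrC addrACA.
Qed.

(** The real parts of iterated square roots approach the identity at the rate
    [3 ^- n], which beats the exponent [2 ^ n] of the power that leads back to
    the given operator. *)
Lemma circle_dyadic_roots C D : C * C + D * D = 1 ->
  exists C_ D_ : nat -> csaop,
  [/\ C_ 0%N = C /\ D_ 0%N = D,
      forall n, C_ n * C_ n + D_ n * D_ n = 1,
      forall n, C_ n.+1 * C_ n.+1 - D_ n.+1 * D_ n.+1 = C_ n,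
      forall n, C_ n.+1 * D_ n.+1 + C_ n.+1 * D_ n.+1 = D_ n &
      forall n, opnorm_le ((3^-1) ^+ n) (1 - C_ n.+1)].
Proof.
move=> CD.
have /choice[f fP] (p : csaop * csaop) : exists q : csaop * csaop,
    p.1 * p.1 + p.2 * p.2 = 1 ->
    [/\ q.1 * q.1 + q.2 * q.2 = 1, q.1 * q.1 - q.2 * q.2 = p.1,
        q.1 * q.2 + q.1 * q.2 = p.2, opnorm_le 1 (1 - q.1) &
        forall c, c <= 1 -> opnorm_le c (1 - p.1) ->
          opnorm_le (c / 3) (1 - q.1)].
  have [p1|p1] := pselect (p.1 * p.1 + p.2 * p.2 = 1); last by exists p.
  by have [C' [D' h]] := circle_sqrt Hdot gens_bounded p1; exists (C', D').
pose C_ n := (iter n f (C, D)).1; pose D_ n := (iter n f (C, D)).2.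
have circ n : C_ n * C_ n + D_ n * D_ n = 1.
  by elim: n => [//|n /fP[]].
have CS n : C_ n.+1 * C_ n.+1 - D_ n.+1 * D_ n.+1 = C_ n.
  by have [] := fP _ (circ n).
have DS n : C_ n.+1 * D_ n.+1 + C_ n.+1 * D_ n.+1 = D_ n.
  by have [] := fP _ (circ n).
exists C_, D_; split=> //.
  elim=> [|n IH]; first by rewrite expr0; have [] := fP _ (circ 0%N).
  have [_ _ _ _] := fP _ (circ n.+1).
  rewrite exprSr; apply => //.
  by rewrite exprn_ile1//; lra.
Qed.

(** The generator is [S = lim 2 ^ n D_n], the limit of the scaled imaginary
    parts of the [2 ^ n]-th roots [W_n] of the given rotation [W]. It converges
    because [2 ^ n.+1 D_n.+1 - 2 ^ n D_n = 2 ^ n.+1 D_n.+1 (1 - C_n.+1)]. Next,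
    [1 + i S / 2 ^ n] differs from [W_n] by [o (2 ^- n)], so that its
    [2 ^ n]-th power tends to [W]; and it tends to [e ^ (i S)] by
    [op_exp_compound]. *)
Lemma csa_log C D : C * C + D * D = 1 ->
  exists S, forall x, op_exp ('i \*: S) x = rotation C D x.
Proof.
move=> CD.
have [C_ [D_ [[C0 D0] circ CS DS C1]]] := circle_dyadic_roots CD.
have W_le1 n : opnorm_le 1 (rotation (C_ n) (D_ n)) by apply: rotation_le1.
have iterW n x : iter (2 ^ n) (rotation (C_ n) (D_ n)) x = rotation C D x.
  elim: n x => [|n IH] x; first by rewrite C0 D0.
  rewrite -IH expnSr iterM.
  by apply: eq_iter => y /=;
    rewrite rotationM (mulrC (D_ n.+1) (C_ n.+1)) CS DS.
(* The bound on the n-th increment is [2 ^ n.+1 * 3 ^- n], which is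
   [a n - a n.+1]. *)
pose a n : R := 6 * (2 / 3) ^+ n.
pose S_ n := 2%:R ^+ n * D_ n.
have dS n : opnorm_le (a n - a n.+1) (S_ n.+1 - S_ n).
  have -> : S_ n.+1 - S_ n = 2%:R ^+ n.+1 * (D_ n.+1 * (1 - C_ n.+1)).
    rewrite /S_ -(DS n) exprS; ring.
  have -> : a n - a n.+1 = 2 ^+ n.+1 * (1 * (3^-1) ^+ n).
    by rewrite /a !exprS mul1r exprMn; field.
  apply: csa_leM; first exact: exprn_ge0.
    apply: csa_leX => //.
    exact: (opnorm_leD (opnorm_le1 (H := H)) (opnorm_le1 (H := H))).
  apply: csa_leM => //.
  by apply: (@circle_le1 _ _ _ _ Hdot _ (C_ n.+1)); rewrite addrC.
have a_ge0 n : 0 <= a n by rewrite mulr_ge0// exprn_ge0//; lra.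
have [S HS] :=
  csa_telescope_limit Hdot gens_bounded dS a_ge0 (@geometric_small R 6).
have [c0 Sc0] := csa_bounded S.
pose c := `|c0|; have Sc : opnorm_le c S := opnorm_leW (ler_norm c0) Sc0.
have c_ge0 : 0 <= c by exact: normr_ge0.
have Tc : opnorm_le c ('i \*: S) by move=> y; rewrite /= nrm_i.
have bT : bounded_op ('i \*: S).
  by exists c%:C%C => y; rewrite !nrmE -rmorphM lecR; exact: Tc.
exists S => x.
pose E n y : H := y + (((2 ^ n)%:R)^-1 : R[i]) *: ('i \*: S) y.
have tE n : ((2 ^ n)%:R^-1 : R[i]) = ((2 ^+ n)^-1)%:C%C.
  by rewrite fmorphV/= rmorphXn/= rmorph_nat natrX.
have t0 n : 0 <= (2 ^+ n)^-1 :> R by rewrite invr_ge0 exprn_ge0.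
have E_W n y : nrm (E n.+1 y - rotation (C_ n.+1) (D_ n.+1) y) <=
    ((3^-1) ^+ n + (2 ^+ n.+1)^-1 * a n.+1) * nrm y.
  have -> : E n.+1 y - rotation (C_ n.+1) (D_ n.+1) y =
      (1 - C_ n.+1) y + 'i *: (((2 ^ n.+1)%:R)^-1 *: (S - S_ n.+1) y).
    have -> : ((2 ^ n.+1)%:R)^-1 *: (S - S_ n.+1) y =
        ((2 ^ n.+1)%:R)^-1 *: S y - D_ n.+1 y.
      rewrite csaDE csaNE /S_ -natrX csaME csa_natE scalerBr scalerA mulVf.
        by rewrite scale1r.
      by rewrite pnatr_eq0 expn_eq0.
    rewrite scalerBr scalerA mulrC -scalerA csaDE csaNE csa1E.
    by rewrite /E /rotation opprD addrACA.
  rewrite (le_trans (nrmD _ _))// nrm_i tE nrmZr ger0_norm// mulrDl.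
  apply: lerD; first exact: C1.
  by rewrite -mulrA ler_wpM2l//; exact: HS.
have E_b n : opnorm_le (1 + c / 2 ^+ n) (E n).
  move=> y; rewrite /E (le_trans (nrmD _ _))// mulrDl mul1r lerD2l.
  by rewrite tE nrmZr ger0_norm// [c / _]mulrC -mulrA ler_wpM2l//; exact: Tc.
have E_ba n : bounded_additive (E n).
  split; last by exists (1 + c / 2 ^+ n).
  by move=> y z; rewrite /E linearD/= scalerDr addrACA.
have near_W n : nrm (iter (2 ^ n.+1) (E n.+1) x - rotation C D x) <=
    9 * expR c * nrm x * (2 / 3) ^+ n.+1.
  rewrite -(iterW n.+1).
  have b1 : 1 <= 1 + c / 2 ^+ n.+1 by rewrite lerDl mulr_ge0.
  have d0 : 0 <= (3^-1) ^+ n + (2 ^+ n.+1)^-1 * a n.+1.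
    by rewrite addr_ge0 ?exprn_ge0 ?mulr_ge0.
  apply: le_trans (iter_dist_le _ x (E_ba n.+1) b1 d0 (E_b n.+1)
    (W_le1 n.+1) (E_W n)) _.
  rewrite [leRHS]mulrAC ler_wpM2r ?nrm_ge0//.
  have -> : (2 ^ n.+1)%:R * ((3^-1) ^+ n + (2 ^+ n.+1)^-1 * a n.+1) =
      9 * (2 / 3) ^+ n.+1.
    rewrite natrX mulrDr mulrA divff ?mul1r ?expf_neq0//.
    by rewrite /a !exprS !exprMn; field.
  rewrite [leRHS]mulrAC ler_wpM2l ?mulr_ge0 ?exprn_ge0//.
  have -> : expR c = expR (c / 2 ^+ n.+1) ^+ (2 ^ n.+1).
    by rewrite -expRM_natl natrX mulrCA divff ?mulr1 ?expf_neq0.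
  by rewrite lerXn2r ?nnegrE ?expR_ge0 ?expR_ge1Dx// (le_trans ler01).
have near_exp n : nrm (series (op_exp_coeff ('i \*: S) x) (2 ^ n).+1 -
    iter (2 ^ n) (E n) x) <= expR c * c ^+ 2 * nrm x * (2 / 3) ^+ n.
  have N0 : (0 < 2 ^ n)%N by rewrite expn_gt0.
  apply: (le_trans (op_exp_compound x c_ge0 Tc N0)).
  rewrite mulrAC ler_wpM2l ?mulr_ge0 ?expR_ge0 ?exprn_ge0 ?nrm_ge0//.
  rewrite natrX -exprVn lerXn2r// ?nnegrE; lra.
apply/eqP; rewrite -subr_eq0; apply/eqP/nrm_eq0/eqP.
rewrite eq_le nrm_ge0 andbT; apply: le_eps => e e0; rewrite add0r.
have e3 : 0 < e / 3 by rewrite divr_gt0.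
have x1 : 0 < nrm x + 1 by rewrite ltr_wpDl// nrm_ge0.
have e1 : (0 : R[i]) < (e / 3 / (nrm x + 1))%:C%C by rewrite ltcR divr_gt0.
have [N1 _ H1] := op_exp_norm_cvg bT e1.
have [N2 H2] := geometric_small (9 * expR c * nrm x) e3.
have [N3 H3] := geometric_small (expR c * c ^+ 2 * nrm x) e3.
pose n := (N1 + N2 + N3)%N.
have h1 : nrm (op_exp ('i \*: S) x -
    series (op_exp_coeff ('i \*: S) x) (2 ^ n.+1).+1) <= e / 3.
  have N1n : (N1 <= (2 ^ n.+1).+1)%N.
    rewrite -ltnS ltnW// !ltnS (leq_trans _ (ltnW (ltn_expl n.+1 (leqnn 2))))//.
    by rewrite leqW// /n -addnA leq_addr.
  have := H1 _ N1n x; rewrite !nrmE -rmorphM lecR => /le_trans; apply.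
  by rewrite mulrAC ler_pdivrMr// ler_pM2l// lerDl.
have h2 := le_trans (near_W n) (H2 n.+1 _).
have h3 := le_trans (near_exp n.+1) (H3 n.+1 _).
have N2n : (N2 <= n.+1)%N by rewrite leqW// /n addnAC leq_addl.
have N3n : (N3 <= n.+1)%N by rewrite leqW// /n leq_addl.
move: (h2 N2n) (h3 N3n) => {}h2 {}h3.
apply: le_trans
  (nrm_triangle (series (op_exp_coeff ('i \*: S) x) (2 ^ n.+1).+1) _ _) _.
have := nrm_triangle (iter (2 ^ n.+1) (E n.+1) x)
  (series (op_exp_coeff ('i \*: S) x) (2 ^ n.+1).+1) (rotation C D x).
lra.
Qed.

End Rotation.

(** * Conjugations and real and imaginary parts of unitary operators *)

Section Assembly.
Context {R : realType} {H : completeNormedModType R[i]}.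
Variable dot : {dot H for Num.conj}.
Hypothesis Hdot : induces_norm dot.
Implicit Types (x y z u v : H) (T : {linear H -> H}).

Lemma Re_norm_ge0 (a : R[i]) : 0 <= complex.Re `|a|.
Proof. by rewrite -lecR (RRe_real (normr_real _)) normr_ge0. Qed.

Lemma conj_half_i : (- 'i / 2)^* = 'i / 2 :> R[i].
Proof. by rewrite fmorph_div rmorphN/= conjCi opprK rmorph_nat. Qed.

Lemma dot_eq u v u' v' : rdot dot u v = rdot dot u' v' ->
  rdot dot ('i *: u) v = rdot dot ('i *: u') v' -> dot u v = dot u' v'.
Proof.
rewrite /rdot !linearZl_LR/= => eRe eIm.
move: eRe eIm; case: (dot u v) (dot u' v') => [a b] [a' b'] /= -> h.
by congr (Complex _ _); lra.
Qed.

Lemma dot_ext u v : (forall z, dot u z = dot v z) -> u = v.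
Proof.
move=> uv; apply/eqP; rewrite -subr_eq0 -(dnorm_eq0 dot).
by rewrite linearBl subr_eq0; apply/eqP; exact: uv.
Qed.

(** Polarization. *)
Lemma isometry_dot T : (forall x, nrm (T x) = nrm x) ->
  forall x y, dot (T x) (T y) = dot x y.
Proof.
move=> T1.
have Tr x y : rdot dot (T x) (T y) = rdot dot x y.
  have h z : rdot dot (T z) (T z) = rdot dot z z by rewrite !rdotE// T1.
  have := h (x + y); rewrite linearD !rdotDl !rdotDr !h.
  rewrite (rdotC dot y x) (rdotC dot (T y) (T x)); lra.
by move=> x y; apply: dot_eq; rewrite -?linearZ Tr.
Qed.

Lemma dot_isometry (f : H -> H) :
  (forall x y, rdot dot (f x) (f y) = rdot dot x y) ->
  forall x, nrm (f x) = nrm x.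
Proof.
by move=> fr x; apply/eqP; rewrite eq_le !(nrm_le_rdot Hdot)// fr.
Qed.

Section Conjugation.
Variable J : H -> H.
Hypothesis HJ : conjugation dot J.

Lemma conjugationK : involutive J. Proof. exact: HJ.1. Qed.

Lemma conjugation_dot x y : dot (J x) (J y) = (dot x y)^*.
Proof. exact: HJ.2. Qed.

(** Tested against vectors [J z], which exhaust [H]. *)
Lemma conjugation_antilinear (a : R[i]) x y : J (a *: x + y) = a^* *: J x + J y.
Proof.
apply: dot_ext => z; rewrite -(conjugationK z) linearDl linearZl_LR/=.
by rewrite !conjugation_dot linearDl linearZl_LR/= rmorphD rmorphM.
Qed.

Lemma conjugationD x y : J (x + y) = J x + J y.
Proof. by rewrite -[x]scale1r conjugation_antilinear rmorph1 !scale1r. Qed.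

Lemma conjugation0 : J 0 = 0.
Proof. by apply: (addrI (J 0)); rewrite -conjugationD !addr0. Qed.

Lemma conjugationZ (a : R[i]) x : J (a *: x) = a^* *: J x.
Proof. by rewrite -[a *: x]addr0 conjugation_antilinear conjugation0 addr0. Qed.

Lemma conjugationB x y : J (x - y) = J x - J y.
Proof. by rewrite -scaleN1r conjugationD conjugationZ rmorphN1 scaleN1r. Qed.

Lemma conjugation_rdot x y : rdot dot (J x) (J y) = rdot dot x y.
Proof.
by apply/complexI; rewrite /rdot conjugation_dot !complexRe; exact: Re_conj.
Qed.

Lemma conjugation_bounded_additive : bounded_additive J.
Proof.
split; first exact: conjugationD.
by exists 1 => x; rewrite mul1r (dot_isometry conjugation_rdot).
Qed.

End Conjugation.

Section HermitianParts.
Variables U U' : {linear H -> H}.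
Hypothesis UK : cancel U U'.
Hypothesis U'K : cancel U' U.
Hypothesis Uadj : forall x y, dot (U x) y = dot x (U' y).

Definition re_part : {linear H -> H} := 2^-1 \*: (U \+ U').
Definition im_part : {linear H -> H} := (- 'i / 2) \*: (U \- U').
Definition hermitian_parts : set {linear H -> H} := [set re_part; im_part].

Lemma re_partE x : re_part x = 2^-1 *: (U x + U' x). Proof. by []. Qed.
Lemma im_partE x : im_part x = (- 'i / 2) *: (U x - U' x). Proof. by []. Qed.

Lemma Uadj' x y : dot (U' x) y = dot x (U y).
Proof. by rewrite -{2}(U'K x) Uadj UK. Qed.

Lemma nrm_U x : nrm (U x) = nrm x.
Proof. by apply: dot_isometry => {}x y; rewrite /rdot Uadj UK. Qed.

Lemma nrm_U' x : nrm (U' x) = nrm x.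
Proof. by apply: dot_isometry => {}x y; rewrite /rdot Uadj' U'K. Qed.

Lemma hermitian_parts_bounded g :
  hermitian_parts g -> exists c, opnorm_le c g.
Proof.
case=> ->.
  exists (complex.Re `|2^-1 : R[i]| * 2) => x.
  rewrite re_partE nrmZ -mulrA ler_wpM2l//.
    exact: Re_norm_ge0.
  by rewrite (le_trans (nrmD _ _))// nrm_U nrm_U'; lra.
exists (complex.Re `|- 'i / 2 : R[i]| * 2) => x.
rewrite im_partE nrmZ -mulrA ler_wpM2l//.
  exact: Re_norm_ge0.
by rewrite (le_trans (nrmD _ _))// nrmN nrm_U nrm_U'; lra.
Qed.

Lemma hermitian_parts_sym g x y :
  hermitian_parts g -> dot (g x) y = dot x (g y).
Proof.
case=> ->.
  rewrite !re_partE linearZl_LR linearZr_LR/= linearDl (linearDr dot)/=.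
  by rewrite Uadj Uadj' fmorphV rmorph_nat addrC.
rewrite !im_partE linearZl_LR linearZr_LR/= linearBl (linearBr dot)/=.
rewrite Uadj Uadj' conj_half_i.
by rewrite -[in RHS]opprB mulrN !mulNr.
Qed.

Lemma hermitian_parts_commute_linear g T : hermitian_parts g ->
  commutes T U -> commutes T U' -> commutes T g.
Proof.
move=> hg TU TU' x; case: hg => ->.
  by rewrite !re_partE linearZ/= linearD/= TU TU'.
by rewrite !im_partE linearZ/= linearB/= TU TU'.
Qed.

Lemma hermitian_parts_commute g g' : hermitian_parts g -> hermitian_parts g' ->
  commutes g g'.
Proof.
move=> hg hg'; apply: hermitian_parts_commute_linear => // x; apply/esym.
  by apply: hermitian_parts_commute_linear => // z; rewrite UK U'K.
by apply: hermitian_parts_commute_linear => // z; rewrite UK U'K.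
Qed.

Lemma hermitian_parts_csa g :
  hermitian_parts g -> csa_spec dot hermitian_parts g.
Proof.
move=> hg; split=> [a x y||x y|g' hg'|F _ FC].
- by rewrite linearP.
- exact: hermitian_parts_bounded.
- by rewrite /rdot hermitian_parts_sym.
- exact: hermitian_parts_commute.
- exact: FC.
Qed.

Lemma hermitian_parts_decomp : exists C D : csaop dot hermitian_parts,
  [/\ C * C + D * D = 1, C =1 re_part & D =1 im_part].
Proof.
exists (CsaOp (hermitian_parts_csa (or_introl erefl))).
exists (CsaOp (hermitian_parts_csa (or_intror erefl))).
split=> //; apply: csa_inj => x.
rewrite csaDE !csaME csa1E /= !linearD !linearN/=.
rewrite !linearZ/= !UK !U'K !scalerA.
rewrite (_ : _ * (- 'i / 2) = - (2^-1 * 2^-1)); last first.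
  by rewrite mulrACA mulrNN -expr2 sqrCi mulN1r.
rewrite !scaleNr !scalerN !opprK; set q := _ * _.
set a := q *: U _; set b := q *: U' _.
rewrite (addrC a) (addrC (- a)) (addrACA _ a) (addrACA _ (- a)) [LHS]addrACA.
rewrite -opprD subrr addr0 -!scalerDl -[RHS]scale1r; congr (_ *: _).
by rewrite /q; field.
Qed.

Lemma hermitian_parts_rotation x : re_part x + 'i *: im_part x = U x.
Proof.
rewrite re_partE im_partE scalerA mulrA mulrN -expr2 sqrCi opprK mul1r.
rewrite -scalerDr addrACA subrr addr0 scalerDr -scalerDl.
by rewrite -[2^-1]mul1r -splitr scale1r.
Qed.

End HermitianParts.

(** The antilinearity of [J] cancels the exchange of [U] and its inverse. *)
Lemma conjugation_commutes J (U U' : {linear H -> H}) : conjugation dot J ->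
  (forall x, J (U x) = U' (J x)) -> (forall x, J (U' x) = U (J x)) ->
  in_commutant (hermitian_parts U U') J.
Proof.
move=> HJ JU JU' g [] -> x.
  rewrite !re_partE (conjugationZ HJ) (conjugationD HJ) JU JU' addrC.
  by rewrite fmorphV rmorph_nat.
rewrite !im_partE (conjugationZ HJ) (conjugationB HJ) JU JU'.
by rewrite conj_half_i -opprB scalerN mulNr scaleNr.
Qed.

Lemma linear_of (f : H -> H) : linear f -> exists T, T =1 f.
Proof.
move=> lf; pose F := GRing.isLinear.Build _ _ _ _ f lf.
pose T : {linear H -> H} := HB.pack f F.
by exists T.
Qed.

Lemma unitary_op_nrm T : unitary_op dot T -> forall x, nrm (T x) = nrm x.
Proof. by move=> [TT _]; apply: dot_isometry => x y; rewrite /rdot TT. Qed.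

Lemma unitary_op_inverse T : unitary_op dot T ->
  exists T' : {linear H -> H}, cancel T T' /\ cancel T' T.
Proof.
move=> HT; have [TT /choice[f Tf]] := HT.
have Tinj : injective T.
  move=> x y Txy; apply/eqP; rewrite -subr_eq0; apply/eqP/nrm_eq0.
  by rewrite -(unitary_op_nrm HT) linearB/= Txy subrr nrm0.
have [|T' T'f] := @linear_of f.
  by move=> a x y; apply: Tinj; rewrite linearP/= !Tf.
by exists T'; split=> x; rewrite T'f//; apply: Tinj; rewrite Tf.
Qed.

End Assembly.

Theorem theorem2p2 (R : realType) (H : completeNormedModType R[i])
    (dot : {dot H for Num.conj}) (J : H -> H) (A : {linear H -> H})
    (Hdot : induces_norm dot) (Hsep : separable_space H)
    (HJ : conjugation dot J) (HA : unitary_op dot A) :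
  exists V S : {linear H -> H},
    [/\ unitary_op dot V /\ J_real J V,
        [/\ bounded_op S, selfadjoint_op dot S & J_real J S]
      & forall x, A x = V (op_exp ('i \*: S) x)].
Proof.
have [AA _] := HA; have JK := conjugationK HJ.
have [B [AK BK]] := unitary_op_inverse Hdot HA.
(* If [A = V W] with [V] J-real and [J W J] the inverse of [W], then
   [J A^-1 J A = W ^ 2]. *)
have [|U UE] := @linear_of _ _ (fun x => J (B (J (A x)))).
  move=> a x y; rewrite linearP/= (conjugation_antilinear HJ) linearP/=.
  by rewrite (conjugation_antilinear HJ) conjCK.
have [|U' U'E] := @linear_of _ _ (fun x => B (J (A (J x)))).
  move=> a x y; rewrite (conjugation_antilinear HJ) linearP/=.
  by rewrite (conjugation_antilinear HJ) conjCK linearP.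
have UK : cancel U U' by move=> x; rewrite U'E UE JK BK JK AK.
have U'K : cancel U' U by move=> x; rewrite U'E UE BK JK AK JK.
have Uadj x y : dot (U x) y = dot x (U' y).
  by rewrite UE -[y in LHS]JK HJ.2 -AA BK -HJ.2 JK -[RHS]AA U'E BK.
have JU x : J (U x) = U' (J x) by rewrite UE U'E JK JK.
have JU' x : J (U' x) = U (J x) by rewrite UE U'E.
pose gens := hermitian_parts U U'.
have gens_b : forall g, gens g -> exists c, opnorm_le c g.
  exact: hermitian_parts_bounded.
have [C0 [D0 [CD0 C0E D0E]]] := hermitian_parts_decomp Hdot UK U'K Uadj.
have [C [D [CD CC CDD _ _]]] := circle_sqrt Hdot gens_b CD0.
have [S SE] := csa_log Hdot gens_b CD.
pose V : {linear H -> H} := A \o (C \+ ('i \*: (- D))).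
have VE x : V x = A (rotation C (- D) x) by [].
have WK : cancel (rotation C D) (rotation C (- D)).
  move=> x; rewrite rotationM (_ : C * C - - D * D = 1) -?CD; last by ring.
  rewrite (_ : C * D + - D * C = 0); last by ring.
  by rewrite CD /rotation csa1E csa0E scaler0 addr0.
have WK' : cancel (rotation C (- D)) (rotation C D).
  move=> x; rewrite rotationM (_ : C * C - D * - D = 1) -?CD; last by ring.
  rewrite (_ : C * - D + D * C = 0); last by ring.
  by rewrite CD /rotation csa1E csa0E scaler0 addr0.
have W2 x : rotation C D (rotation C D x) = U x.
  rewrite rotationM (mulrC D C) CC CDD /rotation C0E D0E.
  exact: hermitian_parts_rotation.
have J_csa (T : csaop dot gens) x : J (T x) = T (J x).
  have JC := conjugation_commutes HJ JU JU'.
  exact: (csa_commutes T (conjugation_bounded_additive Hdot HJ) JC).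
have JW x : J (rotation C D x) = rotation C (- D) (J x).
  rewrite /rotation (conjugationD HJ) (conjugationZ HJ) !J_csa conjCi.
  by rewrite csaNE scalerN scaleNr.
exists V, S; split.
- split; last first.
    move=> x; rewrite !VE.
    have W2' z : rotation C (- D) (rotation C (- D) z) = U' z.
      by rewrite -{1}(U'K z) -W2 !WK.
    by rewrite -JW -{2}[x]WK W2' U'E BK.
  split.
    apply: (isometry_dot Hdot) => x; rewrite VE (unitary_op_nrm Hdot HA).
    apply/eqP; rewrite eq_le; apply/andP; split.
      have := rotation_le1 Hdot (D := - D) _ x; rewrite mul1r; apply.
      by rewrite -CD; ring.
    by have := rotation_le1 Hdot CD (rotation C (- D) x); rewrite WK' mul1r.
  by move=> y; exists (rotation C D (B y)); rewrite VE WK BK.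
- split.
  + have [c Sc] := csa_bounded S; exists c%:C%C => x.
    by rewrite !nrmE -rmorphM lecR; exact: Sc.
  + move=> x y; apply: dot_eq; first exact: csa_sym.
    by rewrite -linearZ csa_sym.
  + by move=> x; rewrite J_csa JK.
- by move=> x; rewrite SE VE WK.
Qed.
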